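(* Let $G$ be a finite group acting by automorphisms on a ring $R$ such that $|G|$ is invertible in $R$. If $R$ is right dual Kasch, then the skew group ring $R*G$ is right dual Kasch.
   Context: Rings are associative, unital and non-trivial; modules are unital. A ring $R$ is right dual Kasch if every simple right $R$-module is isomorphic to a factor module of an injective right $R$-module. A group $G$ acts on a ring $R$ by automorphisms if a group homomorphism $G\to\mathrm{Aut}(R)$ is given; the action of $g\in G$ on $a\in R$ is denoted $g\cdot a$. The skew group ring $R*G$ is the free left $R$-module with basis $\{\overline{g}: g\in G\}$ and multiplication determined by $(a\overline{g})(b\overline{h})=a(g\cdot b)\overline{gh}$ for all $a,b\in R$, $g,h\in G$. *)

(* Defs.v *)
From HB Require Import structures.
From mathcomp Require Import all_boot all_fingroup all_algebra.
From mathcomp Require Import generic_quotient.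
Set Implicit Arguments.
Unset Strict Implicit.
Unset Printing Implicit Defensive.
Import GRing.Theory.
Local Open Scope ring_scope.
Local Open Scope quotient_scope.

(* [submodClosed] does not record closure under opposite, which the quotient
   construction of ring_quotient requires; [zmod_of] restores it. *)
Section QuotientModule.
Variables (A : pzRingType) (V : lmodType A).

Definition zmod_of (K : submodClosed V) : {pred V} := fun x => x \in K.

Variable K : submodClosed V.

Fact zmod_of_closed : zmod_closed (zmod_of K).
Proof.
split=> [|x y Kx Ky]; first exact: (rpred0 K).
by rewrite /zmod_of unfold_in -scaleN1r (rpredD Kx) // rpredZ.
Qed.
HB.instance Definition _ := GRing.isZmodClosed.Build V (zmod_of K) zmod_of_closed.

Definition quotmod : Type := Quotient.quot (zmod_of K).
HB.instance Definition _ := GRing.Zmodule.on quotmod.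

Definition quotmod_pi (x : V) : quotmod := \pi_(Quotient.quot (zmod_of K)) x.

Lemma quotmod_pi_eq x y : (quotmod_pi x == quotmod_pi y) = (x - y \in K).
Proof. by rewrite /quotmod_pi -Quotient.idealrBE. Qed.

Lemma quotmod_pi_repr (u : quotmod) : quotmod_pi (repr u) = u.
Proof. exact: reprK. Qed.

Lemma quotmod_piD : {morph quotmod_pi : x y / x + y}.
Proof. by move=> x y; rewrite /quotmod_pi piE. Qed.

Definition quotmod_scale (a : A) (u : quotmod) : quotmod :=
  quotmod_pi (a *: repr u).

Lemma quotmod_piZ a x : quotmod_pi (a *: x) = quotmod_scale a (quotmod_pi x).
Proof.
apply/eqP; rewrite quotmod_pi_eq -scalerBr rpredZ // -quotmod_pi_eq.
by rewrite quotmod_pi_repr.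
Qed.

Fact quotmod_scaleA a b u :
  quotmod_scale a (quotmod_scale b u) = quotmod_scale (a * b) u.
Proof. by rewrite -[u]quotmod_pi_repr -!quotmod_piZ scalerA. Qed.
Fact quotmod_scale1 : left_id 1 quotmod_scale.
Proof. by move=> u; rewrite -[u]quotmod_pi_repr -quotmod_piZ scale1r. Qed.
Fact quotmod_scaleDr : right_distributive quotmod_scale +%R.
Proof.
move=> a u v; rewrite -[u]quotmod_pi_repr -[v]quotmod_pi_repr.
by rewrite -quotmod_piD -!quotmod_piZ scalerDr quotmod_piD.
Qed.
Fact quotmod_scaleDl u : {morph quotmod_scale^~ u : a b / a + b}.
Proof.
move=> a b; rewrite -[u]quotmod_pi_repr.
by rewrite -!quotmod_piZ scalerDl quotmod_piD.
Qed.
HB.instance Definition _ := GRing.Zmodule_isLmodule.Build A quotmod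
  quotmod_scaleA quotmod_scale1 quotmod_scaleDr quotmod_scaleDl.

Fact quotmod_pi_is_linear : linear quotmod_pi.
Proof. by move=> a x y; rewrite quotmod_piD quotmod_piZ. Qed.
HB.instance Definition _ :=
  GRing.isLinear.Build A V quotmod _ quotmod_pi quotmod_pi_is_linear.

End QuotientModule.

Section Modules.
Variable A : pzRingType.

(* Submodules are boolean predicates, as everywhere in the library; under
   classical logic these are all the submodules. *)
Definition simple_module (S : lmodType A) : Prop :=
  (exists x : S, x != 0) /\
  forall U : submodClosed S,
    (forall x, x \in U -> x = 0) \/ (forall x, x \in U).

Definition injective_module (E : lmodType A) : Prop :=
  forall (M N : lmodType A) (i : {linear M -> N}) (f : {linear M -> E}),
    injective i -> exists g : {linear N -> E}, forall x, g (i x) = f x.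

End Modules.

(* A right R-module is a left module over the converse ring R^c. *)
Definition right_dual_kasch (R : nzRingType) : Prop :=
  forall S : lmodType R^c, simple_module S ->
    exists (E : lmodType R^c) (K : submodClosed E),
      injective_module E /\
      exists f : {linear S -> quotmod K}, bijective f.

(* A group morphism from G to Aut(R): the fields say that each [act g] is a
   ring automorphism and that (gh) . a = g . (h . a). *)
Record ring_action (G : finGroupType) (R : nzRingType) := RingAction {
  act :> G -> {rmorphism R -> R};
  act_bij : forall g, bijective (act g);
  actM : forall g h a, act (g * h)%g a = act g (act h a)
}.

Lemma act1 (G : finGroupType) (R : nzRingType) (al : ring_action G R) a :
  al 1%g a = a.
Proof. by apply: (bij_inj (act_bij al 1%g)); rewrite -actM mulg1. Qed.

(* The alias hides the pointwise ring structure of {ffun G -> R}; x g is the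
   coefficient of the basis element [skew_basis al g]. *)
Definition skew_group_ring (G : finGroupType) (R : nzRingType)
  (al : ring_action G R) : Type := {ffun G -> R}.

Section SkewGroupRing.
Variables (G : finGroupType) (R : nzRingType) (al : ring_action G R).
Local Notation RG := (skew_group_ring al).

HB.instance Definition _ := GRing.Zmodule.on RG.
HB.instance Definition _ := GRing.Lmodule.copy RG {ffun G -> R^o}.

Definition skew_coef (x : RG) (g : G) : R := (x : {ffun G -> R}) g.

Definition skew_basis (g : G) : RG := [ffun k => (k == g)%:R].

Definition skew_one : RG := skew_basis 1%g.

(* The coefficient at k collects the (x_g gbar)(y_h hbar) with gh = k. *)
Definition skew_mul (x y : RG) : RG :=
  [ffun k => \sum_g skew_coef x g * al g (skew_coef y (g^-1 * k)%g)].

Lemma skew_coefD x y g : skew_coef (x + y) g = skew_coef x g + skew_coef y g.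
Proof. by rewrite /skew_coef ffunE. Qed.

Lemma skew_coefZ a x g : skew_coef (a *: x) g = a * skew_coef x g.
Proof. by rewrite /skew_coef ffunE. Qed.

Lemma skew_coef_basis g h : skew_coef (skew_basis g) h = (h == g)%:R.
Proof. by rewrite /skew_coef ffunE. Qed.

Lemma skew_coef_mul x y k : skew_coef (skew_mul x y) k =
  \sum_g skew_coef x g * al g (skew_coef y (g^-1 * k)%g).
Proof. by rewrite {1}/skew_coef ffunE. Qed.

Lemma skewP (x y : RG) : (forall g, skew_coef x g = skew_coef y g) -> x = y.
Proof. by move=> eqxy; apply/ffunP. Qed.

Fact skew_mulA : associative skew_mul.
Proof.
move=> x y z; apply: skewP => k; rewrite !skew_coef_mul.
under eq_bigr => g _ do rewrite skew_coef_mul rmorph_sum mulr_sumr.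
under [RHS]eq_bigr => h _ do rewrite skew_coef_mul mulr_suml.
rewrite [RHS]exchange_big; apply: eq_bigr => g _ /=.
rewrite [RHS](reindex_inj (mulgI g)); apply: eq_bigr => h _ /=.
by rewrite rmorphM mulrA invMg mulKg -actM mulgA.
Qed.

Fact skew_mul1 : left_id skew_one skew_mul.
Proof.
move=> x; apply: skewP => k; rewrite skew_coef_mul (bigD1 1%g) //=.
rewrite skew_coef_basis eqxx mul1r act1 invg1 mul1g big1 ?addr0 // => g.
by rewrite skew_coef_basis => /negPf->; rewrite mul0r.
Qed.

Fact skew_mulr1 : right_id skew_one skew_mul.
Proof.
move=> x; apply: skewP => k; rewrite skew_coef_mul (bigD1 k) //=.
rewrite skew_coef_basis mulVg eqxx rmorph1 mulr1 big1 ?addr0 // => g nk.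
by rewrite skew_coef_basis -eq_mulVg1 (negPf nk) rmorph0 mulr0.
Qed.

Fact skew_mulDl : left_distributive skew_mul +%R.
Proof.
move=> x y z; apply: skewP => k; rewrite skew_coefD !skew_coef_mul -big_split.
by apply: eq_bigr => g _; rewrite skew_coefD mulrDl.
Qed.

Fact skew_mulDr : right_distributive skew_mul +%R.
Proof.
move=> x y z; apply: skewP => k; rewrite skew_coefD !skew_coef_mul -big_split.
by apply: eq_bigr => g _; rewrite skew_coefD rmorphD mulrDr.
Qed.

Fact skew_one_neq0 : skew_one != 0.
Proof.
apply/eqP => /ffunP/(_ 1%g)/eqP.
by rewrite -[_ 1%g]/(skew_coef skew_one 1%g) skew_coef_basis ffunE eqxx oner_eq0.
Qed.

HB.instance Definition _ := GRing.Zmodule_isNzRing.Build RG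
  skew_mulA skew_mul1 skew_mulr1 skew_mulDl skew_mulDr skew_one_neq0.

Lemma skew_coef_sum (a : G -> R) k :
  skew_coef (\sum_g a g *: skew_basis g) k = a k.
Proof.
rewrite /skew_coef sum_ffunE (bigD1 k) //= big1 => [|g].
  by rewrite addr0 !ffunE eqxx [LHS]mulr1.
by rewrite eq_sym !ffunE => /negPf->; rewrite [LHS]mulr0.
Qed.

Lemma skew_decomp (x : RG) : x = \sum_g skew_coef x g *: skew_basis g.
Proof. by apply: skewP => k; rewrite skew_coef_sum. Qed.

Lemma skew_basis_mul a b g h :
  (a *: skew_basis g) * (b *: skew_basis h) =
  (a * al g b) *: skew_basis (g * h)%g.
Proof.
apply: skewP => k; rewrite [LHS]skew_coef_mul (bigD1 g) //= big1 => [|i ni].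
  rewrite addr0 !skew_coefZ !skew_coef_basis eqxx mulr1 rmorphM rmorph_nat.
  by rewrite mulrA -(inj_eq (mulgI g)) mulKVg.
by rewrite skew_coefZ skew_coef_basis (negPf ni) mulr0 mul0r.
Qed.

End SkewGroupRing.

(* Main.v *)
Require Import Defs.
From HB Require Import structures.
From mathcomp Require Import all_boot all_fingroup all_algebra.
From mathcomp Require Import generic_quotient boolp.
From mathcomp Require classical_sets.
Import GRing.Theory.
Local Open Scope ring_scope.

Set Implicit Arguments.
Unset Strict Implicit.

(** Write RG for the skew group ring and let S be a simple right RG-module. The
proof produces an injective right R-module E with a nonzero R-linear map
e : E -> S, and then induces it up to RG.

To get e it is enough to find a simple R-submodule L of S, because the
hypothesis on R writes L as a factor of an injective module E. This is the
argument behind Clifford's theorem. As s RG = S for any nonzero s, the finitely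
many elements s gbar generate S over R, and Zorn's lemma gives a maximal
R-submodule M. The intersection of all the translates M gbar is an
RG-submodule other than S, hence zero. Intersect translates as long as the
result L is nonzero: some further translate M hbar then meets L in 0, so L
embeds in the simple R-module S / M hbar and is simple
([simple_has_simple_submodule]).

For the second step, the induced module E RG = (+)_g E gbar is also the
coinduced module Hom_R(RG, E), G being finite. As a coinduced module it is
injective with E ([induced_injective]); as an induced module it receives from e
the RG-linear map sending the sum of the x_g gbar to the sum of the
e(x_g) gbar ([induced_map]). This map to S is nonzero, hence onto as S is
simple, which makes S a factor of E RG. *)

(** * Submodules given by propositions *)

Definition linear_of (A : pzRingType) (V W : lmodType A) (f : V -> W)
    (f_lin : linear f) : {linear V -> W} :=
  HB.pack f (GRing.isLinear.Build A V W _ f f_lin).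

Section Submodules.
Variables (A : pzRingType) (V : lmodType A).

Definition submodule (P : V -> Prop) :=
  P 0 /\ forall a x y, P x -> P y -> P (a *: x + y).

(** The proof [subP] is an argument so that the closure instances below can be
inferred from the predicate alone. *)
Definition submod_pred (P : V -> Prop) (subP : submodule P) : {pred V} :=
  fun x => `[< P x >].

Fact submod_pred_closed P (subP : submodule P) : submod_closed (submod_pred subP).
Proof.
case: (subP) => P0 PZD; split; first exact/asboolP.
by move=> a x y /asboolP Px /asboolP Py; apply/asboolP/PZD.
Qed.
HB.instance Definition _ P (subP : submodule P) :=
  GRing.isSubmodClosed.Build A V (submod_pred subP)
    (GRing.submod_closed_semi (submod_pred_closed subP)).

Definition submod_of_set P (subP : submodule P) : submodClosed V :=
  submod_pred subP.

Lemma submod_of_setP P (subP : submodule P) x : x \in submod_of_set subP <-> P x.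
Proof. by split=> /asboolP. Qed.

Lemma submodule0 P : submodule P -> P 0. Proof. by case. Qed.
Lemma submoduleD P x y : submodule P -> P x -> P y -> P (x + y).
Proof. by case=> _ PZD Px Py; rewrite -[x]scale1r; apply: PZD. Qed.
Lemma submoduleZ P a x : submodule P -> P x -> P (a *: x).
Proof. by case=> P0 PZD Px; rewrite -[_ *: x]addr0; apply: PZD. Qed.
Lemma submoduleB P x y : submodule P -> P x -> P y -> P (x - y).
Proof. by case=> _ PZD Px Py; rewrite addrC -scaleN1r; apply: PZD. Qed.

End Submodules.

Lemma simple_module_set (A : pzRingType) (S : lmodType A) (P : S -> Prop) :
  simple_module S -> submodule P -> (forall x, P x -> x = 0) \/ forall x, P x.
Proof.
case=> _ simS subP; case: (simS (submod_of_set subP)) => PS; [left|right] => x.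
  by move=> Px; apply/PS/submod_of_setP.
by apply/submod_of_setP/PS.
Qed.

(** Schur: the image is a nonzero submodule, so the map is onto and S is E modulo
its kernel. *)
Lemma factor_of_nonzero_map (A : pzRingType) (E S : lmodType A)
    (p : {linear E -> S}) (e : E) :
  simple_module S -> p e != 0 ->
  exists (K : submodClosed E) (f : {linear S -> quotmod K}), bijective f.
Proof.
move=> simS pe0.
have subK : submodule (fun x => p x = 0).
  by split=> [|a x y px py]; rewrite ?raddf0 // linearP px py scaler0 addr0.
have subI : submodule (fun s => exists x, p x == s).
  split=> [|a s t [x /eqP<-] [y /eqP<-]]; first by exists 0; rewrite raddf0.
  by exists (a *: x + y); rewrite linearP.
have p_onto : forall s : S, exists x, p x == s.
  have [p0|//] := simple_module_set simS subI.
  by rewrite (p0 (p e)) ?eqxx // in pe0; exists e.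
(* By [fE], all preimages of s have the class f(s). *)
pose K := submod_of_set subK; pose f (s : S) := quotmod_pi K (xchoose (p_onto s)).
have fE x s : p x = s -> f s = quotmod_pi K x.
  move=> pxs; apply/eqP; rewrite quotmod_pi_eq; apply/submod_of_setP.
  by rewrite linearB /= pxs (eqP (xchooseP (p_onto s))) subrr.
have f_lin : linear f.
  move=> a s t; have [[x /eqP px] [y /eqP py]] := (p_onto s, p_onto t).
  by rewrite (fE x s) // (fE y t) // (fE (a *: x + y)) linearP //= px py.
exists K, (linear_of f_lin); exists (fun u : quotmod K => p (repr u)) => [s|u] /=.
  have /eqP : f s = quotmod_pi K (repr (f s)) by rewrite quotmod_pi_repr.
  have [x /eqP px] := p_onto s; rewrite {1}(fE x) // quotmod_pi_eq.
  by move/submod_of_setP; rewrite linearB /= px => /subr0_eq.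
by rewrite (fE (repr u)) // quotmod_pi_repr.
Qed.

(** * Restriction of scalars *)

Section RestrictionOfScalars.
Variables (A B : pzRingType).

Definition restr (phi : {rmorphism A -> B}) (V : lmodType B) : Type := V.

Variables (phi : {rmorphism A -> B}) (V : lmodType B).
Local Notation resV := (restr phi V).
HB.instance Definition _ := GRing.Zmodule.on resV.
Definition restr_scale (a : A) (x : resV) : resV := phi a *: (x : V).
Fact restr_scaleA a b x : restr_scale a (restr_scale b x) = restr_scale (a * b) x.
Proof. by rewrite /restr_scale scalerA rmorphM. Qed.
Fact restr_scale1 : left_id 1 restr_scale.
Proof. by move=> x; rewrite /restr_scale rmorph1 scale1r. Qed.
Fact restr_scaleDr : right_distributive restr_scale +%R.
Proof. by move=> a x y; rewrite /restr_scale scalerDr. Qed.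
Fact restr_scaleDl x : {morph restr_scale^~ x : a b / a + b}.
Proof. by move=> a b; rewrite /restr_scale rmorphD scalerDl. Qed.
HB.instance Definition _ := GRing.Zmodule_isLmodule.Build A resV
  restr_scaleA restr_scale1 restr_scaleDr restr_scaleDl.

Lemma restr_scaleE a (x : resV) : a *: x = phi a *: (x : V) :> V.
Proof. by []. Qed.

End RestrictionOfScalars.

Lemma restr_linear (A B : pzRingType) (phi : {rmorphism A -> B})
    (V W : lmodType B) (f : {linear V -> W}) :
  linear (f : restr phi V -> restr phi W).
Proof. by move=> a x y; rewrite linearD linearZ. Qed.

(** * Simple and maximal submodules *)

Section Subtype.
Variables (A : pzRingType) (V : lmodType A) (P : V -> Prop) (subP : submodule P).

Definition submod_sort : Type := {x : V | x \in submod_pred subP}.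
HB.instance Definition _ := SubType.on submod_sort.
HB.instance Definition _ := Choice.on submod_sort.
HB.instance Definition _ := [SubChoice_isSubZmodule of submod_sort by <:].
HB.instance Definition _ := [SubZmodule_isSubLmodule of submod_sort by <:].

End Subtype.

Definition simple_submodule (A : pzRingType) (V : lmodType A) (L : V -> Prop) :=
  [/\ submodule L, exists2 x, L x & x != 0 &
      forall U : V -> Prop, submodule U -> (forall x, U x -> L x) ->
        (exists2 x, U x & x != 0) -> forall x, L x -> U x].

Lemma simple_submod_sort (A : pzRingType) (V : lmodType A) (L : V -> Prop)
    (subL : submodule L) :
  simple_submodule L -> simple_module (submod_sort subL).
Proof.
case=> _ [x Lx x0] minL; split.
  by exists (Sub x (asboolT Lx)); apply: contra_neq x0 => /(congr1 val).
move=> U; have [[u Uu u0]|U0] := pselect (exists2 u, u \in U & u != 0); last first.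
  left=> u Uu; apply/eqP/negPn/negP => u0; apply: U0; by exists u.
right; pose U' v := exists2 w, w \in U & val w = v.
have subU' : submodule U'.
  split=> [|a _ _ [v Uv <-] [w Uw <-]]; first by exists 0; rewrite ?rpred0.
  by exists (a *: v + w); rewrite ?linearP // rpredD ?rpredZ.
have U'L v : U' v -> L v by case=> w _ <-; exact: asboolW (valP w).
have U'0 : exists2 v, U' v & v != 0.
  by exists (val u); [exists u | apply: contra_neq u0 => u0; exact: val_inj].
move=> w; have [w' Uw' /val_inj <- //] := minL U' subU' U'L U'0 _ (asboolW (valP w)).
Qed.

(** L is a factor of an injective module E; e is E -> L followed by the
inclusion of L. *)
Lemma dual_kasch_map (R : nzRingType) (V : lmodType R^c) (L : V -> Prop) :
  right_dual_kasch R -> simple_submodule L ->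
  exists (E : lmodType R^c) (e : {linear E -> V}),
    injective_module E /\ exists x, e x != 0.
Proof.
move=> kaschR simL; have [subL [x Lx x0] _] := simL.
have [E [K [injE [f [f' fK f'K]]]]] := kaschR _ (simple_submod_sort subL simL).
have e_lin : linear (fun y => val (f' (quotmod_pi K y))).
  move=> a y z; rewrite -linearP; congr val; apply: (can_inj fK).
  by rewrite f'K [RHS]linearP !f'K linearP.
exists E, (linear_of e_lin); split=> //.
pose t : submod_sort subL := Sub x (asboolT Lx).
by exists (repr (f t)); rewrite /= quotmod_pi_repr fK.
Qed.

Definition maximal_submodule (A : pzRingType) (V : lmodType A) (M : V -> Prop) :=
  [/\ submodule M, exists x, ~ M x &
      forall U : V -> Prop, submodule U -> (forall x, M x -> U x) ->
        (exists2 x, U x & ~ M x) -> forall x, U x].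

(** A nonzero finitely generated module has a maximal submodule: a submodule is
proper iff it misses a generator, and by finiteness the union of a chain of
such submodules still misses one. *)
Lemma ex_maximal_submodule (A : pzRingType) (V : lmodType A) (I : finType)
    (v : I -> V) :
  (forall P, submodule P -> (forall i, P (v i)) -> forall x, P x) ->
  (exists x : V, x != 0) -> exists M : V -> Prop, maximal_submodule M.
Proof.
move=> genV [x x0].
have sub0 : submodule (fun y : V => y = 0).
  by split=> // a y z -> ->; rewrite scaler0 addr0.
have [i0 vi0] : exists i, v i != 0.
  apply: contrapT => v0; case/eqP: x0; apply: (genV _ sub0) => i.
  by apply: contrapT => /eqP vi; apply: v0; exists i.
(* [D] does not ask that 0 belong to N, because the union of the empty chain is
   empty; a maximal N does contain 0, since otherwise N is empty and {0} is
   larger. *)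
pose D (N : V -> Prop) := (forall a y z, N y -> N z -> N (a *: y + z)) /\
  exists i, ~ N (v i).
have [|N [[NZD [i Nvi]] maxN]] := @classical_sets.Zorn_bigcup V D.
  move=> F FD Ftot; split=> [a y z [X FX Xy] [Y FY Yz]|].
    case: (Ftot X Y FX FY) => XY; [exists Y|exists X] => //.
      by apply: (proj1 (FD Y FY)) => //; apply: XY.
    by apply: (proj1 (FD X FX)) => //; apply: XY.
  apply: contrapT => allF.
  have {}allF j : exists2 X, F X & X (v j).
    by apply: contrapT => nj; apply: allF; exists j => -[X FX Xj]; apply: nj; exists X.
  have [X FX Xs] : exists2 X, F X & forall j, j \in enum I -> X (v j).
    elim: (enum I) => [|j s [X FX Xs]]; first by have [X FX _] := allF i0; exists X.
    have [Y FY Yj] := allF j; case: (Ftot X Y FX FY) => XY; [exists Y|exists X] => // k.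
      by rewrite inE => /predU1P[-> //|/Xs/XY].
    by rewrite inE => /predU1P[->|/Xs //]; apply: XY.
  by have [_ [j]] := FD X FX; apply; apply: Xs; rewrite mem_enum.
have N0 : N 0.
  apply: contrapT => N0; case: (maxN (fun y => y = 0)).
    split=> [y Ny|/(_ 0)]; last by auto.
    by case: N0; rewrite -[0](addNr y) -scaleN1r; apply: NZD.
  by split; [case: sub0 | exists i0; apply/eqP].
exists N; split; [by split | by exists (v i) |].
move=> U subU NU [y Uy Ny]; apply: genV => // j.
apply: contrapT => Uj; case: (maxN U); last by split; [case: subU | exists j].
by split=> // /(_ _ Uy).
Qed.

(** * Modules over the skew group ring *)

Section SkewModules.
Variables (G : finGroupType) (R : nzRingType) (al : ring_action G R).
Local Notation RG := (skew_group_ring al).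

(** Right RG-modules are left modules over RG^c, so gbar, the scalars of R and
the coefficients are used with RG^c and R^c as types; multiplying by
[sk_basis g] is x |-> x gbar, and products come in the opposite order. *)
Definition sk_basis (g : G) : RG^c := skew_basis al g.

Definition sk_const (a : R^c) : RG^c := (a : R) *: (1 : RG).

Definition sk_coef (y : RG^c) (g : G) : R^c := skew_coef (y : RG) g.

Lemma sk_constM : {morph sk_const : a b / a * b}.
Proof.
move=> a b; rewrite /sk_const -[RHS]/(((b : R) *: (1 : RG)) * ((a : R) *: (1 : RG)) : RG).
by have := skew_basis_mul al b a 1%g 1%g; rewrite Defs.act1 mulg1 => ->.
Qed.

Fact sk_const_zmod_morphism : zmod_morphism sk_const.
Proof. by move=> a b; rewrite /sk_const scalerBl. Qed.
Fact sk_const_monoid_morphism : monoid_morphism sk_const.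
Proof. by split; [exact: scale1r | exact: sk_constM]. Qed.
HB.instance Definition _ :=
  GRing.isZmodMorphism.Build R^c RG^c sk_const sk_const_zmod_morphism.
HB.instance Definition _ :=
  GRing.isMonoidMorphism.Build R^c RG^c sk_const sk_const_monoid_morphism.

Lemma sk_basisM g h : sk_basis g * sk_basis h = sk_basis (h * g)%g.
Proof.
have := skew_basis_mul al 1 1 h g; rewrite !scale1r rmorph1 mul1r scale1r.
exact.
Qed.

Lemma sk_basis1 : sk_basis 1%g = 1. Proof. by []. Qed.

(** The relation gbar a = (g . a) gbar of the skew group ring. *)
Lemma sk_const_basis a g :
  sk_const a * sk_basis g = sk_basis g * sk_const (al g a).
Proof.
rewrite -[LHS]/((sk_basis g : RG) * (sk_const a : RG)).
rewrite -[RHS]/((sk_const (al g a) : RG) * (sk_basis g : RG)).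
have := skew_basis_mul al 1 a g 1%g; rewrite scale1r mul1r mulg1 => ->.
by have := skew_basis_mul al (al g a) 1 1%g g; rewrite scale1r rmorph1 mulr1 mul1g => ->.
Qed.

Lemma sk_basis_const a g :
  sk_basis g * sk_const a = (a : R) *: (sk_basis g : RG).
Proof.
rewrite -[LHS]/((sk_const a : RG) * (sk_basis g : RG)).
by have := skew_basis_mul al a 1 1%g g; rewrite scale1r rmorph1 mulr1 mul1g.
Qed.

Section Modules.
Variable V : lmodType RG^c.

Lemma scale_basisM g h (x : V) :
  sk_basis g *: (sk_basis h *: x) = sk_basis (h * g)%g *: x.
Proof. by rewrite scalerA sk_basisM. Qed.

Lemma scale_const_basis a g (x : V) :
  sk_const a *: (sk_basis g *: x) = sk_basis g *: (sk_const (al g a) *: x).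
Proof. by rewrite !scalerA sk_const_basis. Qed.

Lemma scale_decomp (y : RG^c) (x : V) :
  y *: x = \sum_g sk_basis g *: (sk_const (sk_coef y g) *: x).
Proof.
rewrite {1}[y](skew_decomp (y : RG)); under [RHS]eq_bigr do rewrite scalerA sk_basis_const.
by rewrite -[RHS]scaler_suml.
Qed.

(** An element of RG is a sum of products of a scalar of R and some gbar, so
stability is to be checked for these two kinds of elements only. *)
Lemma skew_submodule (P : V -> Prop) :
  submodule (P : restr sk_const V -> Prop) ->
  (forall g x, P x -> P (sk_basis g *: x)) -> submodule P.
Proof.
move=> subP Pbasis; split=> [|y u v Pu Pv]; first exact: submodule0 subP.
apply: (submoduleD subP) => //; rewrite scale_decomp.
elim/big_ind: _ => [|u1 u2|g _]; [exact: submodule0 subP|exact: submoduleD subP|].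
exact/Pbasis/(submoduleZ (sk_coef y g) subP).
Qed.

End Modules.

Lemma skew_linear (V W : lmodType RG^c) (f : V -> W) :
  linear (f : restr sk_const V -> restr sk_const W) ->
  (forall g x, f (sk_basis g *: x) = sk_basis g *: f x) -> linear f.
Proof.
move=> f_lin fbasis.
pose fl := linear_of f_lin.
move=> y u v; rewrite -[LHS]/(fl _) (raddfD fl); congr (_ + _).
rewrite !scale_decomp (raddf_sum fl); apply: eq_bigr => g _ /=.
by rewrite fbasis -[f _]/(fl (sk_coef y g *: (u : restr sk_const V))) linearZ.
Qed.

(** * The induced module *)

(** The family u stands for the sum of the u_g gbar in E RG. The action is a
parameter of the type because it determines the scaling by RG. *)
Definition induced (act_R : ring_action G R) (E : lmodType R^c) : Type :=
  {ffun G -> E}.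

Section InducedModule.
Variable E : lmodType R^c.
Local Notation indE := (induced al E).

HB.instance Definition _ := GRing.Zmodule.on indE.

Definition ind_coef (u : indE) (g : G) : E := (u : {ffun G -> E}) g.

Lemma ind_coefD u v g : ind_coef (u + v) g = ind_coef u g + ind_coef v g.
Proof. by rewrite /ind_coef ffunE. Qed.

Lemma inducedP (u v : indE) :
  (forall g, ind_coef u g = ind_coef v g) -> u = v.
Proof. by move=> eq_uv; apply/ffunP. Qed.

(** From (x gbar) (b hbar) = x (g . b) (gh)bar, collecting the terms gh = k. *)
Definition ind_scale (y : RG^c) (u : indE) : indE :=
  [ffun k => \sum_g (al g (sk_coef y (g^-1 * k)%g) : R^c) *: ind_coef u g].

Lemma ind_coef_scale y u k : ind_coef (ind_scale y u) k =
  \sum_g (al g (sk_coef y (g^-1 * k)%g) : R^c) *: ind_coef u g.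
Proof. by rewrite {1}/ind_coef ffunE. Qed.

Fact ind_scaleA y z u : ind_scale y (ind_scale z u) = ind_scale (y * z) u.
Proof.
apply: inducedP => k; rewrite !ind_coef_scale.
under eq_bigr => h _ do rewrite ind_coef_scale scaler_sumr.
rewrite exchange_big; apply: eq_bigr => g _ /=.
rewrite -[sk_coef (y * z) _]/(skew_coef (skew_mul (z : RG) (y : RG)) (g^-1 * k)%g).
rewrite skew_coef_mul rmorph_sum (reindex_inj (mulgI g)) -/R^c /=.
rewrite [RHS]scaler_suml; apply: eq_bigr => h _.
by rewrite scalerA rmorphM -Defs.actM invMg mulKg -mulgA.
Qed.

Fact ind_scale1 : left_id 1 ind_scale.
Proof.
move=> u; apply: inducedP => k; rewrite ind_coef_scale (bigD1 k) //=.
rewrite /sk_coef skew_coef_basis mulVg eqxx rmorph1 scale1r big1 ?addr0 // => g nk.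
by rewrite skew_coef_basis -eq_mulVg1 (negPf nk) rmorph0 scale0r.
Qed.

Fact ind_scaleDr : right_distributive ind_scale +%R.
Proof.
move=> y u v; apply: inducedP => k; rewrite ind_coefD !ind_coef_scale -big_split.
by apply: eq_bigr => g _; rewrite ind_coefD scalerDr.
Qed.

Fact ind_scaleDl u : {morph ind_scale^~ u : y z / y + z}.
Proof.
move=> y z; apply: inducedP => k; rewrite ind_coefD !ind_coef_scale -big_split.
by apply: eq_bigr => g _; rewrite /sk_coef skew_coefD rmorphD scalerDl.
Qed.

HB.instance Definition _ := GRing.Zmodule_isLmodule.Build RG^c indE
  ind_scaleA ind_scale1 ind_scaleDr ind_scaleDl.

Lemma ind_coef_basis h (u : indE) k :
  ind_coef (sk_basis h *: u) k = ind_coef u (k * h^-1)%g.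
Proof.
rewrite [LHS]ind_coef_scale (bigD1 (k * h^-1)%g) //= /sk_coef skew_coef_basis.
rewrite invMg invgK mulgKV eqxx rmorph1 scale1r big1 ?addr0 // => g nk.
rewrite skew_coef_basis; case: eqP => [gkh|]; last by rewrite rmorph0 scale0r.
by case/eqP: nk; rewrite -gkh invMg invgK mulKVg.
Qed.

Lemma ind_coef_const a (u : indE) k :
  ind_coef (sk_const a *: u) k = (al k a : R^c) *: ind_coef u k.
Proof.
rewrite [LHS]ind_coef_scale (bigD1 k) //= /sk_coef skew_coefZ skew_coef_basis.
rewrite mulVg eqxx mulr1 big1 ?addr0 // => g nk.
by rewrite skew_coefZ skew_coef_basis -eq_mulVg1 (negPf nk) mulr0 rmorph0 scale0r.
Qed.

End InducedModule.

(** Taking the coefficient at 1 is the universal R-linear map from the induced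
module to E: an RG-linear f is recovered from its coefficient p at 1, as the
coefficient at k of f(n) is p (n kbar^-1). So extend p to an R-linear q using
the injectivity of E, and rebuild an RG-linear map from q. *)
Lemma induced_injective (E : lmodType R^c) :
  injective_module E -> injective_module (induced al E).
Proof.
move=> injE M N i f i_inj.
have p_lin : linear (fun m : restr sk_const M => ind_coef (f m) 1%g).
  move=> a x y; rewrite (linearD f) ind_coefD; congr (_ + _).
  by rewrite restr_scaleE linearZ /= ind_coef_const Defs.act1.
have i_lin : linear (i : restr sk_const M -> restr sk_const N).
  exact: restr_linear.
have [q qp] := injE _ _ (linear_of i_lin) (linear_of p_lin) i_inj.
pose g n : induced al E :=
  [ffun k => q (sk_basis k^-1%g *: n : restr sk_const N)].
have gE n k : ind_coef (g n) k = q (sk_basis k^-1%g *: n).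
  by rewrite /ind_coef ffunE.
have g_lin : linear g.
  apply: skew_linear => [a x y|h n]; apply: inducedP => k.
    rewrite ind_coefD [ind_coef (_ *: _) k]ind_coef_const !gE -linearZ -linearD.
    congr (q _); rewrite scalerDr restr_scaleE; congr (_ + _).
    by rewrite restr_scaleE scale_const_basis -Defs.actM mulVg Defs.act1.
  by rewrite ind_coef_basis !gE scale_basisM invMg invgK.
exists (linear_of g_lin) => m; apply: inducedP => k /=; rewrite gE -linearZ [q _]qp /=.
by rewrite linearZ ind_coef_basis invgK mul1g.
Qed.

Lemma induced_map (E : lmodType R^c) (S : lmodType RG^c)
    (e : {linear E -> restr sk_const S}) :
  exists p : {linear induced al E -> S},
    forall u, p u = \sum_g sk_basis g *: (e (ind_coef u g) : S).
Proof.
pose p (u : induced al E) : S := \sum_g sk_basis g *: (e (ind_coef u g) : S).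
have p_lin : linear p.
  apply: skew_linear => [a u v|h u]; rewrite /p.
    rewrite [X in _ = X + _]scaler_sumr -big_split; apply: eq_bigr => g _ /=.
    rewrite ind_coefD linearD scalerDr; congr (_ + _).
    by rewrite ind_coef_const linearZ !restr_scaleE scale_const_basis.
  rewrite scaler_sumr (reindex_inj (mulIg h)); apply: eq_bigr => g _.
  by rewrite ind_coef_basis mulgK scale_basisM.
by exists (linear_of p_lin).
Qed.

(** * A simple submodule over the coefficient ring *)

Lemma scale_basis_const (V : lmodType RG^c) a g (x : V) :
  sk_basis g *: (sk_const a *: x) = sk_const (al g^-1%g a) *: (sk_basis g *: x).
Proof. by rewrite scale_const_basis -Defs.actM mulgV Defs.act1. Qed.

Section Translates.
Variables (V : lmodType RG^c) (P : restr sk_const V -> Prop).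
Hypothesis subP : submodule P.

(** The intersection of the P gbar^-1 for g in B. *)
Definition meet_translates (B : {set G}) (x : restr sk_const V) :=
  forall g, g \in B -> P (sk_basis g *: (x : V)).

Lemma meet_translates_submodule B : submodule (meet_translates B).
Proof.
split=> [g _|a x y Px Py g Bg]; first by rewrite scaler0; exact: submodule0 subP.
rewrite scalerDr restr_scaleE scale_basis_const.
by apply: (submoduleD subP); [exact/(submoduleZ _ subP)/Px | exact: Py].
Qed.

Lemma meet_all_translates_submodule :
  submodule (meet_translates [set: G] : V -> Prop).
Proof.
apply: skew_submodule; first exact: meet_translates_submodule.
by move=> g x Px h _; rewrite scale_basisM; apply: Px; rewrite inE.
Qed.

Lemma meet_all_translates_sub x : meet_translates [set: G] x -> P x.
Proof. by move/(_ 1%g); rewrite inE sk_basis1 scale1r; apply. Qed.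

End Translates.

(** Clifford's argument: a largest set B of translates of a maximal submodule M
with nonzero intersection is not all of G, and its intersection meets one more
translate in 0. *)
Lemma simple_has_simple_submodule (S : lmodType RG^c) :
  simple_module S -> exists L : restr sk_const S -> Prop, simple_submodule L.
Proof.
move=> simS; have [[s s0] _] := simS.
have [||M [subM [m nMm] maxM]] :=
  @ex_maximal_submodule _ (restr sk_const S) G (fun g => sk_basis g *: (s : S)).
(* The s gbar generate: a submodule P containing them has its intersection of
   translates nonzero, as it contains s, hence equal to S. *)
- move=> P subP Ps x; apply: meet_all_translates_sub.
  have [P0|//] := simple_module_set simS (meet_all_translates_submodule subP).
  by case/eqP: s0; apply: P0 => g _; apply: Ps.
- by exists s.
have M_core x : meet_translates M [set: G] x -> x = 0.
  have [M0|M1] := simple_module_set simS (meet_all_translates_submodule subM).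
    exact: M0.
  by case: nMm; apply: meet_all_translates_sub.
pose nz B := `[< exists2 x, meet_translates M B x & x != 0 >].
have [|B /maxsetP[/asboolP nzB maxB]] := @ex_maxset _ nz.
  by exists set0; apply/asboolP; exists s => // g; rewrite inE.
have [h nBh] : exists h, h \notin B.
  apply: contrapT => allB; case: nzB => x Bx /eqP[]; apply: M_core => g _.
  by apply: Bx; apply: contrapT => /negP nBg; apply: allB; exists g.
have meet_h x : meet_translates M B x -> M (sk_basis h *: (x : S)) -> x = 0.
  move=> Bx Mhx; apply: contrapT => /eqP x0; case/negP: nBh.
  have <- : (h |: B) = B; last exact: setU11.
  apply: maxB; last exact: subsetUr.
  by apply/asboolP; exists x => // g /setU1P[->|/Bx].
exists (meet_translates M B); split=> //; first exact: meet_translates_submodule.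
move=> U subU UL [u Uu u0] x Lx.
(* W = M + U hbar strictly contains M, hence is everything. *)
pose W (y : restr sk_const S) := exists2 w, U w & M (y - sk_basis h *: (w : S)).
have subW : submodule W.
  split=> [|a y z [v Uv Mv] [w Uw Mw]].
    by exists 0; rewrite ?scaler0 ?subr0; [exact: submodule0 subU|exact: submodule0 subM].
  exists ((al h a : R^c) *: v + w); first by case: subU => _; apply.
  rewrite scalerDr restr_scaleE -scale_const_basis opprD addrACA -scalerBr.
  by case: subM => _; apply.
have [||w Uw Mw] := maxM W subW _ _ (sk_basis h *: (x : S)).
- by move=> y My; exists 0; [exact: submodule0 subU | rewrite scaler0 subr0].
- exists (sk_basis h *: (u : S)); last by move/(meet_h _ (UL u Uu))/eqP; apply/negP.
  by exists u => //; rewrite subrr; exact: submodule0 subM.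
suff /subr0_eq-> : x - w = 0 by [].
apply: meet_h; last by rewrite scalerBr.
by apply: (submoduleB (meet_translates_submodule subM B)) => //; exact: UL.
Qed.

End SkewModules.

(** * Dual Kasch skew group rings *)

Unset Implicit Arguments.

Theorem proposition2p10 (G : finGroupType) (R : nzRingType)
  (al : ring_action G R)
  (cardG_inv : exists u : R, u * #|G|%:R = 1 /\ #|G|%:R * u = 1)
  (kaschR : right_dual_kasch R) :
  right_dual_kasch (skew_group_ring al).
Proof.
move=> S simS; have [L simL] := simple_has_simple_submodule simS.
have [E [e [injE [x ex0]]]] := dual_kasch_map kaschR simL.
have [p pE] := induced_map e.
(* The element x 1bar of the induced module; p sends it to e(x). *)
pose u : induced al E := [ffun g => if g == 1%g then x else 0].
have pu0 : p u != 0.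
  rewrite pE (bigD1 1%g) //= /ind_coef ffunE eqxx sk_basis1 scale1r big1 ?addr0 //.
  by move=> g /negPf ng; rewrite ffunE ng raddf0 scaler0.
have [K fK] := factor_of_nonzero_map simS pu0.
by exists (induced al E), K; split=> //; exact: induced_injective.
Qed.
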